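(* Let $d\in\mathbb N$ and let $\alpha>0$ and $\varepsilon>0$ be real numbers. Then the set \[ \left\{\,\operatorname{qcd}(P)\ \middle|\ P \text{ is a } d\text{-dimensional lattice polytope with } \alpha\text{-canonical normal fan and } \operatorname{qcd}(P)\ge \varepsilon\,\right\} \] is finite.
   Context: A lattice polytope $P\subseteq\mathbb R^d$ is a polytope all of whose vertices lie in $\mathbb Z^d$; a $d$-dimensional one is written (after a lattice-preserving change of coordinates) as $P=\{x\in\mathbb R^d\mid \langle a_i,x\rangle\le b_i,\ 1\le i\le n\}$, where the system is irredundant (no inequality can be dropped without changing $P$, so each defines a facet) and each $a_i\in(\mathbb Z^d)^*$ is primitive (the gcd of its entries is $1$). For rational $c>0$ the adjoint polytope is $P^{(c)}=\{x\mid \langle a_i,x\rangle\le b_i-c,\ 1\le i\le n\}$. The $\mathbb Q$-codegree $\operatorname{qcd}(P)$ is defined by $\operatorname{qcd}(P)^{-1}=\max\{c>0\mid P^{(c)}\neq\emptyset\}$. The normal fan $\Sigma_P\subseteq(\mathbb R^d)^*$ is the complete fan whose cones are the cones $\operatorname{cone}(a_i\mid i\in I)$ where $I$ is the set of facets containing a given face of $P$; its rays are generated by $a_1,\dots,a_n$. For a rational polyhedral cone $\sigma$ with primitive ray generators $a_1,\dots,a_k$, the height of $y\in\sigma$ is $\operatorname{height}(y)=\max\{\sum_{i=1}^k\lambda_i\mid y=\sum_{i=1}^k\lambda_i a_i,\ \lambda_i\ge0\}$. The cone $\sigma$ is $\alpha$-canonical if $\operatorname{height}(y)\ge\alpha$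 for every nonzero $y\in\sigma\cap(\mathbb Z^d)^*$; a fan is $\alpha$-canonical if every cone in it is. *)

(* Defs.v *)
From Stdlib Require Import Reals ZArith List.
Open Scope R_scope.

(* Vectors in R^d (and (Z^d)^* ) are represented as functions on nat;
   only the coordinates j < d are meaningful. *)

Fixpoint sumR (n : nat) (f : nat -> R) : R :=
  match n with
  | O => 0
  | S m => sumR m f + f m
  end.

Definition dot (d : nat) (a : nat -> Z) (x : nat -> R) : R :=
  sumR d (fun j => IZR (a j) * x j).

Fixpoint gcd_upto (d : nat) (a : nat -> Z) : Z :=
  match d with
  | O => 0%Z
  | S m => Z.gcd (gcd_upto m a) (a m)
  end.

Definition primitive (d : nat) (a : nat -> Z) : Prop := gcd_upto d a = 1%Z.

Definition inP (d n : nat) (a : nat -> nat -> Z) (b : nat -> R) (x : nat -> R) : Prop :=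
  forall i, (i < n)%nat -> dot d (a i) x <= b i.

Definition bounded (d n : nat) (a : nat -> nat -> Z) (b : nat -> R) : Prop :=
  exists M : R, forall x, inP d n a b x -> forall j, (j < d)%nat -> Rabs (x j) <= M.

Definition full_dim (d n : nat) (a : nat -> nat -> Z) (b : nat -> R) : Prop :=
  exists pts : nat -> (nat -> R),
    (forall k, (k <= d)%nat -> inP d n a b (pts k)) /\
    forall mu : nat -> R,
      (forall j, (j < d)%nat ->
         sumR d (fun k => mu k * (pts (S k) j - pts O j)) = 0) ->
      forall k, (k < d)%nat -> mu k = 0.

Definition is_vertex (d n : nat) (a : nat -> nat -> Z) (b : nat -> R) (x : nat -> R) : Prop :=
  inP d n a b x /\
  forall (y z : nat -> R) (t : R),
    inP d n a b y -> inP d n a b z -> 0 < t < 1 ->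
    (forall j, (j < d)%nat -> x j = t * y j + (1 - t) * z j) ->
    forall j, (j < d)%nat -> y j = z j.

Definition lattice_vertices (d n : nat) (a : nat -> nat -> Z) (b : nat -> R) : Prop :=
  forall x, is_vertex d n a b x -> forall j, (j < d)%nat -> exists k : Z, x j = IZR k.

Definition irredundant (d n : nat) (a : nat -> nat -> Z) (b : nat -> R) : Prop :=
  forall i, (i < n)%nat ->
    exists x, (forall i', (i' < n)%nat -> i' <> i -> dot d (a i') x <= b i') /\
              b i < dot d (a i) x.

Definition lattice_polytope_desc (d n : nat) (a : nat -> nat -> Z) (b : nat -> R) : Prop :=
  bounded d n a b /\ full_dim d n a b /\ lattice_vertices d n a b /\
  irredundant d n a b /\ (forall i, (i < n)%nat -> primitive d (a i)).

Definition tight (d n : nat) (a : nat -> nat -> Z) (b : nat -> R) (x : nat -> R) (i : nat) : Prop :=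
  dot d (a i) x = b i.

Definition cone_rep (d n : nat) (a : nat -> nat -> Z) (I_ : nat -> Prop)
    (y : nat -> R) (lam : nat -> R) : Prop :=
  (forall i, (i < n)%nat -> 0 <= lam i) /\
  (forall i, (i < n)%nat -> ~ I_ i -> lam i = 0) /\
  (forall j, (j < d)%nat -> y j = sumR n (fun i => lam i * IZR (a i j))).

Definition in_cone (d n : nat) (a : nat -> nat -> Z) (I_ : nat -> Prop) (y : nat -> R) : Prop :=
  exists lam, cone_rep d n a I_ y lam.

Definition is_height (d n : nat) (a : nat -> nat -> Z) (I_ : nat -> Prop)
    (y : nat -> R) (h : R) : Prop :=
  (exists lam, cone_rep d n a I_ y lam /\ sumR n lam = h) /\
  (forall lam, cone_rep d n a I_ y lam -> sumR n lam <= h).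

Definition alpha_canonical_cone (d n : nat) (a : nat -> nat -> Z) (I_ : nat -> Prop)
    (alpha : R) : Prop :=
  forall y : nat -> Z,
    (exists j, (j < d)%nat /\ y j <> 0%Z) ->
    in_cone d n a I_ (fun j => IZR (y j)) ->
    exists h, is_height d n a I_ (fun j => IZR (y j)) h /\ alpha <= h.

(* The cones of the normal fan are cone(a_i | i in I(F)) for faces F of P;
   each such I(F) is the set of inequalities tight at a (relative interior)
   point x of P, and conversely each tight set of a point of P is some I(F). *)
Definition alpha_canonical_fan (d n : nat) (a : nat -> nat -> Z) (b : nat -> R)
    (alpha : R) : Prop :=
  forall x, inP d n a b x -> alpha_canonical_cone d n a (tight d n a b x) alpha.

Definition adjoint_nonempty (d n : nat) (a : nat -> nat -> Z) (b : nat -> R) (c : R) : Prop :=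
  exists x, forall i, (i < n)%nat -> dot d (a i) x <= b i - c.

Definition is_qcd (d n : nat) (a : nat -> nat -> Z) (b : nat -> R) (q : R) : Prop :=
  0 < q /\ adjoint_nonempty d n a b (/ q) /\
  forall c, 0 < c -> adjoint_nonempty d n a b c -> c <= / q.

Definition finite_setR (S : R -> Prop) : Prop :=
  exists l : list R, forall q, S q -> In q l.

(* Main.v *)
(** By LP duality, [c = 1/qcd(P)] is [sum beta_i b_i] for convex weights [beta] with
    [sum beta_i a_i = 0], supported (Caratheodory) on at most [d + 1] constraints for which
    [beta] is the only such relation, and the [b_i] are integers because every facet contains
    a lattice vertex.  If [N] is integral, [mu = T beta - N >= 0] and [sum mu_i < alpha], then the
    lattice point [sum mu_i a_i = - sum N_i a_i] has height less than [alpha] in its cone of the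
    normal fan, so it vanishes and [N] is proportional to [beta].  Near any given point of the
    simplex, Dirichlet approximation produces one such [N] that serves all [beta] at once, so
    [beta] is locally unique; by compactness only finitely many [beta] occur, all of them
    rational, and then [c <= 1/eps] leaves finitely many values of [c]. *)

Require Import Defs.
From Stdlib Require Import Reals ZArith List Lra Lia Classical.
Open Scope R_scope.

(** * Finite sums *)

Lemma sumR_ext n f g :
  (forall i, (i < n)%nat -> f i = g i) -> sumR n f = sumR n g.
Proof.
  induction n as [|n IH]; intros H; simpl; [reflexivity|].
  rewrite IH by (intros; apply H; lia). rewrite H by lia. reflexivity.
Qed.

Lemma sumR_lin n s t f g :
  sumR n (fun i => s * f i + t * g i) = s * sumR n f + t * sumR n g.
Proof. induction n as [|n IH]; simpl; [ring|rewrite IH; ring]. Qed.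

Lemma sumR_scal n s f : sumR n (fun i => s * f i) = s * sumR n f.
Proof. induction n as [|n IH]; simpl; [ring|rewrite IH; ring]. Qed.

Lemma sumR_minus n f g : sumR n (fun i => f i - g i) = sumR n f - sumR n g.
Proof. induction n as [|n IH]; simpl; [ring|rewrite IH; ring]. Qed.

Lemma sumR_le n f g :
  (forall i, (i < n)%nat -> f i <= g i) -> sumR n f <= sumR n g.
Proof.
  induction n as [|n IH]; intros H; simpl; [lra|].
  assert (sumR n f <= sumR n g) by (apply IH; intros; apply H; lia).
  assert (f n <= g n) by (apply H; lia). lra.
Qed.

Lemma sumR_const n c : sumR n (fun _ => c) = INR n * c.
Proof.
  induction n as [|n IH]; [simpl; ring|].
  rewrite S_INR. simpl. rewrite IH. ring.
Qed.

Lemma sumR_eq0 n f : (forall i, (i < n)%nat -> f i = 0) -> sumR n f = 0.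
Proof.
  intros H. rewrite (sumR_ext n f (fun _ => 0) H), sumR_const. ring.
Qed.

Lemma sumR_nonneg n f : (forall i, (i < n)%nat -> 0 <= f i) -> 0 <= sumR n f.
Proof.
  intros H. replace 0 with (sumR n (fun _ => 0)) by (apply sumR_eq0; auto).
  apply sumR_le; assumption.
Qed.

Lemma sumR_nonneg_eq0 n f :
  (forall i, (i < n)%nat -> 0 <= f i) -> sumR n f <= 0 ->
  forall i, (i < n)%nat -> f i = 0.
Proof.
  induction n as [|n IH]; intros H Hs i Hi; [lia|]. simpl in Hs.
  assert (0 <= sumR n f) by (apply sumR_nonneg; intros; apply H; lia).
  assert (0 <= f n) by (apply H; lia).
  destruct (Nat.eq_dec i n) as [->|]; [lra|].
  apply IH; [intros; apply H; lia|lra|lia].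
Qed.

Lemma sumR_swap m n (f : nat -> nat -> R) :
  sumR m (fun i => sumR n (fun j => f i j)) = sumR n (fun j => sumR m (fun i => f i j)).
Proof.
  induction m as [|m IH]; simpl.
  - symmetry. apply sumR_eq0; auto.
  - rewrite IH. rewrite (sumR_ext n (fun j => sumR m (fun i => f i j) + f m j)
      (fun j => 1 * sumR m (fun i => f i j) + 1 * f m j)) by (intros; ring).
    rewrite sumR_lin, !Rmult_1_l. reflexivity.
Qed.

Lemma sumR_IZR n f :
  (forall i, (i < n)%nat -> exists z, f i = IZR z) -> exists z, sumR n f = IZR z.
Proof.
  induction n as [|n IH]; intros H; simpl; [exists 0%Z; reflexivity|].
  destruct IH as [z Hz]; [intros; apply H; lia|].
  destruct (H n) as [w Hw]; [lia|]. exists (z + w)%Z. rewrite plus_IZR. congruence.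
Qed.

(** Used to delete the index [p] from a finite family: [skip p] runs through all other indices, and
    [unskip p] inverts it there. *)
Definition skip (p i : nat) : nat := if Nat.ltb i p then i else S i.
Definition unskip (p i : nat) : nat := if Nat.ltb i p then i else pred i.

Lemma skip_lt p i n : (i < n)%nat -> (skip p i < S n)%nat.
Proof. unfold skip. destruct (Nat.ltb_spec i p); lia. Qed.

Lemma skip_neq p i : skip p i <> p.
Proof. unfold skip. destruct (Nat.ltb_spec i p); lia. Qed.

Lemma unskip_skip p i : unskip p (skip p i) = i.
Proof.
  unfold skip, unskip. destruct (Nat.ltb_spec i p).
  - destruct (Nat.ltb_spec i p); lia.
  - destruct (Nat.ltb_spec (S i) p); simpl; lia.
Qed.

Lemma sumR_skip n p f :
  (p <= n)%nat -> sumR (S n) f = f p + sumR n (fun i => f (skip p i)).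
Proof.
  induction n as [|n IH]; intros Hp.
  - replace p with O by lia. simpl; ring.
  - destruct (Nat.eq_dec p (S n)) as [->|Hne].
    + simpl. rewrite (sumR_ext n (fun i => f (skip (S n) i)) f).
      2:{ intros i Hi. unfold skip. destruct (Nat.ltb_spec i (S n)); [reflexivity|lia]. }
      unfold skip. destruct (Nat.ltb_spec n (S n)); [ring|lia].
    + change (sumR (S (S n)) f) with (sumR (S n) f + f (S n)).
      rewrite IH by lia. simpl. unfold skip at 3.
      destruct (Nat.ltb_spec n p); [lia|ring].
Qed.

(** * Vectors and scalar products *)

(** Real coefficients allow arbitrary objectives. [dot d a] is convertible to
    [dotR d (fun j => IZR (a j))], which the later [change] steps exploit. *)
Definition dotR (d : nat) (u x : nat -> R) : R := sumR d (fun j => u j * x j).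

Definition comb (s : R) (x : nat -> R) (t : R) (y : nat -> R) : nat -> R :=
  fun j => s * x j + t * y j.

Definition unitv (k : nat) : nat -> R := fun j => if Nat.eq_dec j k then 1 else 0.

Lemma dotR_comb d u s x t y : dotR d u (comb s x t y) = s * dotR d u x + t * dotR d u y.
Proof.
  unfold dotR, comb. rewrite <- sumR_lin. apply sumR_ext; intros; ring.
Qed.

Lemma dotR_ext d u x y : (forall j, (j < d)%nat -> x j = y j) -> dotR d u x = dotR d u y.
Proof. intros H. apply sumR_ext. intros j Hj. rewrite H by assumption. reflexivity. Qed.

Lemma dotR_unitv d u k : (k < d)%nat -> dotR d u (unitv k) = u k.
Proof.
  intros H. unfold dotR. destruct d as [|d]; [lia|]. rewrite (sumR_skip d k) by lia.
  rewrite sumR_eq0.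
  - unfold unitv. destruct (Nat.eq_dec k k); [ring|congruence].
  - intros i _. unfold unitv. destruct (Nat.eq_dec (skip k i) k) as [e|]; [|ring].
    destruct (skip_neq k i e).
Qed.

Lemma dotR_unitv_out d u k : (d <= k)%nat -> dotR d u (unitv k) = 0.
Proof.
  intros H. apply sumR_eq0. intros i Hi. unfold unitv.
  destruct (Nat.eq_dec i k); [lia|ring].
Qed.

Lemma dotR_sum d n (lam : nat -> R) (A : nat -> nat -> R) x :
  sumR n (fun i => lam i * dotR d (A i) x) =
  dotR d (fun j => sumR n (fun i => lam i * A i j)) x.
Proof.
  unfold dotR.
  rewrite (sumR_ext n _ (fun i => sumR d (fun j => lam i * A i j * x j))).
  - rewrite sumR_swap. apply sumR_ext. intros j _.
    rewrite (sumR_ext n _ (fun i => x j * (lam i * A i j))) by (intros; ring).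
    rewrite sumR_scal. ring.
  - intros i _. rewrite <- sumR_scal. apply sumR_ext; intros; ring.
Qed.

(** * Linear programming *)

Definition linear (f : (nat -> R) -> R) : Prop :=
  forall s x t y, f (comb s x t y) = s * f x + t * f y.

(* Relativising to a subspace [K] makes the induction on the number of functionals
   elementary: a binding constraint [f n] is turned into the equation [f n = 0] by
   shrinking [K], and a point violating it fixes (and makes positive) its multiplier. *)
Lemma farkas_subspace n : forall (f : nat -> (nat -> R) -> R) g (K : (nat -> R) -> Prop),
  (forall i, (i < n)%nat -> linear (f i)) -> linear g ->
  (forall s x t y, K x -> K y -> K (comb s x t y)) ->
  (forall x, K x -> (forall i, (i < n)%nat -> f i x <= 0) -> g x <= 0) ->
  exists lam, (forall i, (i < n)%nat -> 0 <= lam i) /\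
              forall x, K x -> g x = sumR n (fun i => lam i * f i x).
Proof.
  induction n as [|n IH]; intros f g K Hf Hg HK H.
  - exists (fun _ => 0). split; [intros; lra|]. intros x Hx. simpl.
    assert (g x <= 0) by (apply H; [assumption|intros; lia]).
    (* [K] also contains the negative of [x], so [g] vanishes on [K]. *)
    assert (H1 : g (comb (-1) x 0 x) <= 0) by (apply H; [apply HK; assumption|intros; lia]).
    rewrite Hg in H1. lra.
  - destruct (classic (forall x, K x -> (forall i, (i < n)%nat -> f i x <= 0) -> g x <= 0))
      as [Hd|Hd].
    + destruct (IH f g K) as (lam & Hl & He); auto.
      exists (fun i => if Nat.eq_dec i n then 0 else lam i). split.
      * intros i Hi. destruct (Nat.eq_dec i n); [lra|apply Hl; lia].
      * intros x Hx. simpl. destruct (Nat.eq_dec n n); [|congruence].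
        rewrite He by assumption. rewrite Rmult_0_l, Rplus_0_r. apply sumR_ext.
        intros i Hi. destruct (Nat.eq_dec i n); [lia|reflexivity].
    + apply not_all_ex_not in Hd. destruct Hd as [x0 Hd].
      apply imply_to_and in Hd. destruct Hd as [K0 Hd].
      apply imply_to_and in Hd. destruct Hd as [F0 G0]. apply Rnot_le_lt in G0.
      assert (Fn : 0 < f n x0).
      { apply Rnot_le_lt. intros Hle. apply Rlt_not_le in G0. apply G0, H; [assumption|].
        intros i Hi. destruct (Nat.eq_dec i n) as [->|]; [assumption|apply F0; lia]. }
      assert (Ln : linear (f n)) by (apply Hf; lia).
      destruct (IH f g (fun x => K x /\ f n x = 0)) as (lam & Hl & He); auto.
      { intros s x t y [Kx fx] [Ky fy]. split; [auto|]. rewrite Ln, fx, fy. ring. }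
      { intros x [Kx fx] Hx. apply H; [assumption|]. intros i Hi.
        destruct (Nat.eq_dec i n) as [->|]; [lra|apply Hx; lia]. }
      set (S0 := sumR n (fun i => lam i * f i x0)).
      assert (HS : S0 <= 0).
      { replace 0 with (sumR n (fun _ => 0)) by (apply sumR_eq0; auto).
        apply sumR_le. intros i Hi. specialize (Hl i Hi). specialize (F0 i Hi). nra. }
      exists (fun i => if Nat.eq_dec i n then (g x0 - S0) / f n x0 else lam i). split.
      * intros i Hi. destruct (Nat.eq_dec i n); [|apply Hl; lia].
        apply Rlt_le, Rdiv_lt_0_compat; lra.
      * intros x Kx. simpl. destruct (Nat.eq_dec n n); [|congruence].
        (* Project [x] along [x0] to the hyperplane [f n = 0], where the multipliers found by
           induction apply. *)
        specialize (He (comb 1 x (- (f n x / f n x0)) x0)).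
        rewrite Hg in He.
        rewrite (sumR_ext n _ (fun i => 1 * (lam i * f i x)
           + (- (f n x / f n x0)) * (lam i * f i x0))) in He.
        2:{ intros i Hi. rewrite Hf by lia. ring. }
        rewrite sumR_lin in He. fold S0 in He.
        rewrite (sumR_ext n _ (fun i => lam i * f i x)).
        2:{ intros i Hi. destruct (Nat.eq_dec i n); [lia|reflexivity]. }
        assert (E : 1 * g x + - (f n x / f n x0) * g x0 =
          1 * sumR n (fun i => lam i * f i x) + - (f n x / f n x0) * S0).
        { apply He. split; [auto|]. rewrite Ln. field. lra. }
        assert (g x = sumR n (fun i => lam i * f i x) + f n x / f n x0 * (g x0 - S0)) by lra.
        rewrite H0. field. lra.
Qed.

Definition polyh (d n : nat) (A : nat -> nat -> R) (b : nat -> R) (x : nat -> R) : Prop :=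
  forall i, (i < n)%nat -> dotR d (A i) x <= b i.

Lemma linear_dotR_homog d u c k : linear (fun x => dotR d u x - c * x k).
Proof. intros s x t y. rewrite dotR_comb. unfold comb. ring. Qed.

(** Farkas on the homogenized cone: a point with positive last coordinate rescales into the
    polyhedron, and one with last coordinate zero is a recession direction, along which the bounded
    objective cannot grow. Evaluating the resulting identity at unit vectors reads off the dual
    solution. *)
Lemma lp_duality d n A b G M :
  (exists x, polyh d n A b x) -> (forall x, polyh d n A b x -> dotR d G x <= M) ->
  exists lam, (forall i, (i < n)%nat -> 0 <= lam i) /\
    (forall j, (j < d)%nat -> G j = sumR n (fun i => lam i * A i j)) /\
    sumR n (fun i => lam i * b i) <= M.
Proof.
  intros [x0 Hx0] HM.
  (* coordinate [d] is the homogenizing variable *)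
  pose (f i := if Nat.eq_dec i n then fun x : nat -> R => - x d
               else fun x => dotR d (A i) x - b i * x d).
  destruct (farkas_subspace (S n) f (fun x => dotR d G x - M * x d) (fun _ => True))
    as (lam & Hl & He); auto.
  - intros i Hi. unfold f. destruct (Nat.eq_dec i n).
    + intros s x t y. unfold comb. ring.
    + apply linear_dotR_homog.
  - apply linear_dotR_homog.
  - intros x _ Hx.
    assert (Ht : 0 <= x d).
    { specialize (Hx n (Nat.lt_succ_diag_r n)). unfold f in Hx.
      destruct (Nat.eq_dec n n); [lra|congruence]. }
    assert (HA : forall i, (i < n)%nat -> dotR d (A i) x - b i * x d <= 0).
    { intros i Hi. specialize (Hx i (Nat.lt_lt_succ_r _ _ Hi)). unfold f in Hx.
      destruct (Nat.eq_dec i n); [lia|assumption]. }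
    destruct (Rle_lt_or_eq_dec 0 (x d) Ht) as [Hpos|H0].
    + assert (H1 : dotR d G (comb (/ x d) x 0 x) <= M).
      { apply HM. intros i Hi. rewrite dotR_comb. specialize (HA i Hi).
        apply Rmult_le_reg_l with (x d); [assumption|].
        replace (x d * (/ x d * dotR d (A i) x + 0 * dotR d (A i) x)) with (dotR d (A i) x)
          by (field; lra). lra. }
      rewrite dotR_comb in H1. apply (Rmult_le_compat_l (x d)) in H1; [|assumption].
      replace (x d * (/ x d * dotR d G x + 0 * dotR d G x)) with (dotR d G x) in H1
          by (field; lra). lra.
    + rewrite <- H0, Rmult_0_r, Rminus_0_r. apply Rnot_lt_le. intros Hgt.
      (* This step length makes the objective overshoot [M] by one. *)
      pose (s := (M - dotR d G x0 + 1) / dotR d G x).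
      assert (Hx0M := HM _ Hx0).
      assert (Hs : 0 <= s) by (apply Rlt_le, Rdiv_lt_0_compat; lra).
      assert (H1 : dotR d G (comb 1 x0 s x) <= M).
      { apply HM. intros i Hi. rewrite dotR_comb. specialize (HA i Hi).
        specialize (Hx0 i Hi). rewrite <- H0 in HA. nra. }
      rewrite dotR_comb in H1. unfold s in H1.
      replace ((M - dotR d G x0 + 1) / dotR d G x * dotR d G x) with
        (M - dotR d G x0 + 1) in H1 by (field; lra). lra.
  - assert (Hf : forall x, sumR (S n) (fun i => lam i * f i x) =
        sumR n (fun i => lam i * (dotR d (A i) x - b i * x d)) - lam n * x d).
    { intros x. simpl. unfold f at 2. destruct (Nat.eq_dec n n); [|congruence].
      rewrite (sumR_ext n _ (fun i => lam i * (dotR d (A i) x - b i * x d))); [ring|].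
      intros i Hi. unfold f. destruct (Nat.eq_dec i n); [lia|reflexivity]. }
    exists lam. split; [intros; apply Hl; lia|]. split.
    + intros j Hj. specialize (He (unitv j) I). rewrite Hf, dotR_unitv in He by assumption.
      assert (E : unitv j d = 0) by (unfold unitv; destruct (Nat.eq_dec d j); [lia|reflexivity]).
      rewrite E in He.
      rewrite (sumR_ext n _ (fun i => lam i * A i j)) in He; [lra|].
      intros i Hi. rewrite dotR_unitv by assumption. ring.
    + specialize (He (unitv d) I). rewrite Hf, dotR_unitv_out in He by lia.
      assert (E : unitv d d = 1) by (unfold unitv; destruct (Nat.eq_dec d d); congruence).
      rewrite E in He.
      rewrite (sumR_ext n _ (fun i => -1 * (lam i * b i))) in He.
      2:{ intros i Hi. rewrite dotR_unitv_out by lia. ring. }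
      rewrite sumR_scal in He.
      assert (0 <= lam n) by (apply Hl; lia). lra.
Qed.

(** If the supremum [m] is missed, the homogenized demand that the objective be at least [m] forces
    [x d <= 0]. The Farkas multipliers of this implication give a uniform gap
    [1 <= lam n * (m - dotR d G x)] on the polyhedron, contradicting the choice of [m]. *)
Lemma lp_attained d n A b G M :
  (exists x, polyh d n A b x) -> (forall x, polyh d n A b x -> dotR d G x <= M) ->
  exists v, polyh d n A b v /\ forall x, polyh d n A b x -> dotR d G x <= dotR d G v.
Proof.
  intros [x0 Hx0] HM.
  destruct (completeness (fun r => exists x, polyh d n A b x /\ r = dotR d G x)) as [m [Hub Hlub]].
  { exists M. intros r (x & Hx & ->). auto. }
  { exists (dotR d G x0), x0. auto. }
  apply NNPP. intros Hno.
  assert (Hlt : forall x, polyh d n A b x -> dotR d G x < m).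
  { intros x Hx. apply Rnot_le_lt. intros Hle. apply Hno. exists x. split; [assumption|].
    intros y Hy. apply Rle_trans with m; [apply Hub; exists y; auto|assumption]. }
  pose (f i := if Nat.eq_dec i n then fun x : nat -> R => m * x d - dotR d G x
               else fun x => dotR d (A i) x - b i * x d).
  destruct (farkas_subspace (S n) f (fun x => x d) (fun _ => True))
    as (lam & Hl & He); auto.
  - intros i Hi. unfold f. destruct (Nat.eq_dec i n).
    + intros s x t y. rewrite dotR_comb. unfold comb. ring.
    + apply linear_dotR_homog.
  - intros s x t y. reflexivity.
  - intros x _ Hx. apply Rnot_lt_le. intros Hpos.
    assert (Hp : polyh d n A b (comb (/ x d) x 0 x)).
    { intros i Hi. specialize (Hx i (Nat.lt_lt_succ_r _ _ Hi)). unfold f in Hx.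
      destruct (Nat.eq_dec i n); [lia|]. rewrite dotR_comb.
      apply Rmult_le_reg_l with (x d); [assumption|].
      replace (x d * (/ x d * dotR d (A i) x + 0 * dotR d (A i) x)) with (dotR d (A i) x)
        by (field; lra). lra. }
    apply Hlt in Hp. rewrite dotR_comb in Hp.
    apply (Rmult_lt_compat_l (x d)) in Hp; [|assumption].
    replace (x d * (/ x d * dotR d G x + 0 * dotR d G x)) with (dotR d G x) in Hp
        by (field; lra).
    specialize (Hx n (Nat.lt_succ_diag_r n)). unfold f in Hx.
    destruct (Nat.eq_dec n n); [lra|congruence].
  - assert (Ln : 0 <= lam n) by (apply Hl; lia).
    assert (Hgap : forall x, polyh d n A b x -> 1 <= lam n * (m - dotR d G x)).
    { intros x Hx.
      pose (x1 := fun j => if Nat.eq_dec j d then 1 else x j).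
      assert (E1 : x1 d = 1) by (unfold x1; destruct (Nat.eq_dec d d); congruence).
      assert (E2 : forall u, dotR d u x1 = dotR d u x).
      { intros u. apply dotR_ext. intros j Hj. unfold x1.
        destruct (Nat.eq_dec j d); [lia|reflexivity]. }
      specialize (He x1 I). simpl in He. unfold f at 2 in He.
      destruct (Nat.eq_dec n n) as [_|]; [|congruence]. rewrite E1, E2 in He.
      assert (sumR n (fun i => lam i * f i x1) <= 0); [|lra].
      replace 0 with (sumR n (fun _ => 0)) by (apply sumR_eq0; auto).
      apply sumR_le. intros i Hi. unfold f. destruct (Nat.eq_dec i n); [lia|].
      rewrite E1, E2. specialize (Hx i Hi). specialize (Hl i (Nat.lt_lt_succ_r _ _ Hi)). nra. }
    assert (Lp : 0 < lam n).
    { specialize (Hgap x0 Hx0). specialize (Hlt x0 Hx0). nra. }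
    assert (m <= m - / lam n).
    { apply Hlub. intros r (x & Hx & ->). specialize (Hgap x Hx).
      apply Rmult_le_reg_l with (lam n); [assumption|].
      replace (lam n * (m - / lam n)) with (lam n * m - 1) by (field; lra). lra. }
    assert (0 < / lam n) by (apply Rinv_0_lt_compat; assumption). lra.
Qed.

(** * Faces, vertices and integrality of the right-hand sides *)

Lemma polyh_ext d n A b x y :
  (forall j, (j < d)%nat -> x j = y j) -> polyh d n A b x -> polyh d n A b y.
Proof.
  intros E H i Hi. rewrite <- (dotR_ext d (A i) x y E). apply H, Hi.
Qed.

(** The equation [dotR d G x = m] is encoded by one extra inequality with normal [- G], so the
    optimal face is again a [polyh] and maximization can be iterated. *)
Lemma optimal_face d n A b G M :
  (exists x, polyh d n A b x) -> (forall x, polyh d n A b x -> dotR d G x <= M) ->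
  exists A' b' m,
    (forall x, polyh d (S n) A' b' x <-> polyh d n A b x /\ dotR d G x = m) /\
    (exists x, polyh d (S n) A' b' x) /\
    (forall x, polyh d n A b x -> dotR d G x <= m).
Proof.
  intros H0 HM. destruct (lp_attained d n A b G M H0 HM) as (v & Hv & Hmax).
  exists (fun i => if Nat.eq_dec i n then (fun j => - G j) else A i),
    (fun i => if Nat.eq_dec i n then - dotR d G v else b i), (dotR d G v).
  assert (Hopp : forall x, dotR d (fun j => - G j) x = - dotR d G x).
  { intros x. unfold dotR. rewrite (sumR_ext d _ (fun j => -1 * (G j * x j))) by (intros; ring).
    rewrite sumR_scal. ring. }
  assert (Hiff : forall x, polyh d (S n)
      (fun i => if Nat.eq_dec i n then (fun j => - G j) else A i)
      (fun i => if Nat.eq_dec i n then - dotR d G v else b i) x <->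
      polyh d n A b x /\ dotR d G x = dotR d G v).
  { intros x. split.
    - intros Hx. assert (Hp : polyh d n A b x).
      { intros i Hi. specialize (Hx i (Nat.lt_lt_succ_r _ _ Hi)). simpl in Hx.
        destruct (Nat.eq_dec i n); [lia|assumption]. }
      split; [assumption|]. specialize (Hx n (Nat.lt_succ_diag_r n)). simpl in Hx.
      destruct (Nat.eq_dec n n); [|congruence]. rewrite Hopp in Hx.
      specialize (Hmax x Hp). lra.
    - intros [Hp E] i Hi. destruct (Nat.eq_dec i n).
      + rewrite Hopp. lra.
      + apply Hp. lia. }
  split; [assumption|]. split; [|assumption]. exists v. apply Hiff. auto.
Qed.

Definition face_of (P Q : (nat -> R) -> Prop) : Prop :=
  (forall x, Q x -> P x) /\
  forall y z t, P y -> P z -> 0 < t < 1 -> Q (comb t y (1 - t) z) -> Q y /\ Q z.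

(** A proper convex combination attains the maximum of a linear functional only if both endpoints
    do. *)
Lemma face_of_optimal d P Q Q' G m :
  face_of P Q -> (forall x, Q' x <-> Q x /\ dotR d G x = m) ->
  (forall x, Q x -> dotR d G x <= m) -> face_of P Q'.
Proof.
  intros [Hsub Hf] Hiff Hm. split.
  - intros x Hx. apply Hsub, Hiff, Hx.
  - intros y z t Hy Hz Ht Hc. apply Hiff in Hc. destruct Hc as [Hc E].
    destruct (Hf y z t Hy Hz Ht Hc) as [Qy Qz].
    rewrite dotR_comb in E.
    assert (My := Hm y Qy). assert (Mz := Hm z Qz).
    split; apply Hiff; split; auto; nra.
Qed.

Lemma dotR_unitv_l d k x : (k < d)%nat -> dotR d (unitv k) x = x k.
Proof.
  intros H. rewrite <- (dotR_unitv d x k H). apply sumR_ext. intros; ring.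
Qed.

(** Maximize [G], then the coordinates below [k] in turn, passing to the optimal face each time. For
    [k = d] all coordinates are pinned down, which yields a vertex where [G] is maximal. *)
Lemma lex_max_face d n A b G M B :
  (exists x, polyh d n A b x) -> (forall x, polyh d n A b x -> dotR d G x <= M) ->
  (forall x, polyh d n A b x -> forall j, (j < d)%nat -> x j <= B) ->
  forall k, (k <= d)%nat -> exists m A' b',
    (exists x, polyh d m A' b' x) /\
    face_of (polyh d n A b) (polyh d m A' b') /\
    (forall x y, polyh d m A' b' x -> polyh d n A b y -> dotR d G y <= dotR d G x) /\
    (forall j x y, (j < k)%nat -> polyh d m A' b' x -> polyh d m A' b' y -> x j = y j).
Proof.
  intros H0 HM HB. induction k as [|k IH]; intros Hk.
  - destruct (optimal_face d n A b G M H0 HM) as (A' & b' & m & Hiff & He & Hmax).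
    exists (S n), A', b'. split; [assumption|]. split.
    + apply (face_of_optimal d _ (polyh d n A b) _ G m); auto. split; auto.
    + split; [|intros; lia]. intros x y Hx Hy. apply Hiff in Hx. destruct Hx as [_ ->]. auto.
  - destruct IH as (m & A1 & b1 & He & Hf & Hmax & Hun); [lia|].
    destruct (optimal_face d m A1 b1 (unitv k) B He) as (A2 & b2 & mk & Hiff & He2 & Hmax2).
    { intros x Hx. rewrite dotR_unitv_l by lia. apply HB; [|lia]. apply (proj1 Hf), Hx. }
    exists (S m), A2, b2. split; [assumption|]. split.
    + apply (face_of_optimal d _ (polyh d m A1 b1) _ (unitv k) mk); auto.
    + split.
      * intros x y Hx Hy. apply Hiff in Hx. apply Hmax; tauto.
      * intros j x y Hj Hx Hy. apply Hiff in Hx. apply Hiff in Hy.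
        destruct (Nat.eq_dec j k) as [->|].
        -- rewrite !dotR_unitv_l in * by lia. lra.
        -- apply Hun; [lia|tauto|tauto].
Qed.

(** The segment from a point of the polytope to a point violating only inequality [i] crosses the
    hyperplane of [i], and the other inequalities hold along it by convexity. *)
Lemma facet_nonempty d n a b i :
  (exists x, inP d n a b x) -> irredundant d n a b -> (i < n)%nat ->
  exists x, inP d n a b x /\ dot d (a i) x = b i.
Proof.
  intros [p Hp] Hir Hi. destruct (Hir i Hi) as (x & Hx & Hxi).
  assert (Hpi := Hp i Hi).
  pose (u := fun j => IZR (a i j)).
  change (dot d (a i) p) with (dotR d u p) in Hpi.
  change (dot d (a i) x) with (dotR d u x) in Hxi.
  pose (s := (b i - dotR d u p) / (dotR d u x - dotR d u p)).
  assert (Hs0 : 0 <= s).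
  { unfold s. apply Rmult_le_pos; [lra|]. apply Rlt_le, Rinv_0_lt_compat. lra. }
  assert (Hs1 : s <= 1).
  { apply Rmult_le_reg_r with (dotR d u x - dotR d u p); [lra|].
    unfold s, Rdiv. rewrite Rmult_assoc, Rinv_l by lra. lra. }
  assert (E : dotR d u (comb (1 - s) p s x) = b i).
  { rewrite dotR_comb. unfold s. field. lra. }
  exists (comb (1 - s) p s x). split; [|exact E].
  intros i' Hi'. destruct (Nat.eq_dec i' i) as [->|Hne].
  - apply Req_le, E.
  - assert (H1 := Hp i' Hi'). assert (H2 := Hx i' Hi' Hne).
    change (dotR d (fun j => IZR (a i' j)) (comb (1 - s) p s x) <= b i').
    rewrite dotR_comb. unfold dot in H1, H2.
    change (dotR d (fun j => IZR (a i' j)) p <= b i') in H1.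
    change (dotR d (fun j => IZR (a i' j)) x <= b i') in H2. nra.
Qed.

Lemma full_dim_nonempty d n a b : full_dim d n a b -> exists x, inP d n a b x.
Proof. intros (pts & H & _). exists (pts O). apply H. lia. Qed.

(** Lexicographic maximization starting with [a i] ends in a vertex [v], which lies on facet [i]
    because that facet is nonempty. Both [a i] and [v] are integral. *)
Lemma rhs_integer d n a b i :
  lattice_polytope_desc d n a b -> (i < n)%nat -> exists z, b i = IZR z.
Proof.
  intros ([B HB] & Hfd & Hlv & Hir & _) Hi.
  assert (Hne := full_dim_nonempty _ _ _ _ Hfd).
  pose (A := fun i j => IZR (a i j)).
  destruct (lex_max_face d n A b (A i) (b i) B Hne) with (k := d)
    as (m & A' & b' & [v Hv] & Hf & Hmax & Hun); auto.
  { intros x Hx j Hj. specialize (HB x Hx j Hj). assert (H := Rle_abs (x j)). lra. }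
  assert (Pv : inP d n a b v) by (apply (proj1 Hf), Hv).
  assert (V : is_vertex d n a b v).
  { split; [assumption|]. intros y z t Hy Hz Ht E j Hj.
    destruct (proj2 Hf y z t Hy Hz Ht) as [Qy Qz].
    - apply polyh_ext with v; assumption.
    - apply Hun; assumption. }
  destruct (facet_nonempty d n a b i Hne Hir Hi) as (x & Px & Ex).
  assert (Hbv : dot d (a i) v = b i).
  { apply Rle_antisym; [apply Pv, Hi|]. rewrite <- Ex. apply (Hmax v x); assumption. }
  rewrite <- Hbv. apply sumR_IZR. intros j Hj.
  destruct (Hlv v V j Hj) as [k ->]. exists (a i j * k)%Z. rewrite mult_IZR. reflexivity.
Qed.

(** * Circuits *)

Definition independent (D n : nat) (V : nat -> nat -> R) : Prop :=
  forall tau, (forall j, (j < D)%nat -> sumR n (fun i => tau i * V i j) = 0) ->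
  forall i, (i < n)%nat -> tau i = 0.

(** Gaussian elimination on the last coordinate: a pivot vector [p] clears it from the others,
    removing one vector and one coordinate. Without a pivot, the coordinate is dropped alone. *)
Lemma independent_card D : forall n V, independent D n V -> (n <= D)%nat.
Proof.
  induction D as [|D IH]; intros n V Hi.
  - destruct n as [|n]; [lia|]. exfalso.
    assert (H := Hi (fun _ => 1) ltac:(intros; lia) O ltac:(lia)). simpl in H. lra.
  - destruct n as [|n]; [lia|].
    destruct (classic (exists p, (p <= n)%nat /\ V p D <> 0)) as [(p & Hp & Hnz)|Hno].
    + apply le_n_S.
      apply (IH n (fun i j => V (skip p i) j - V (skip p i) D / V p D * V p j)).
      intros tau Ht.
      (* A relation [tau] among the reduced vectors lifts to one among the originals when the pivot
         gets coefficient [- c]. *)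
      pose (c := sumR n (fun i => tau i * V (skip p i) D) / V p D).
      pose (tau' := fun i => if Nat.eq_dec i p then - c else tau (unskip p i)).
      assert (E : forall j, sumR (S n) (fun i => tau' i * V i j) =
        sumR n (fun i => tau i * V (skip p i) j) - c * V p j).
      { intros j. rewrite (sumR_skip n p) by assumption. unfold tau' at 1.
        destruct (Nat.eq_dec p p); [|congruence].
        rewrite (sumR_ext n _ (fun i => tau i * V (skip p i) j)); [ring|].
        intros i _. unfold tau'.
        destruct (Nat.eq_dec (skip p i) p) as [e0|_]; [destruct (skip_neq p i e0)|].
        rewrite unskip_skip. reflexivity. }
      assert (Ht' : forall i, (i < S n)%nat -> tau' i = 0).
      { apply Hi. intros j Hj. rewrite E. destruct (Nat.eq_dec j D) as [->|].
        - unfold c. field. assumption.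
        - rewrite <- (Ht j) by lia.
          rewrite (sumR_ext n (fun i => tau i * (_ - _)) (fun i => 1 * (tau i * V (skip p i) j)
            + (- (V p j / V p D)) * (tau i * V (skip p i) D))) by (intros; field; assumption).
          rewrite sumR_lin. unfold c. field. assumption. }
      intros i Hlt. specialize (Ht' (skip p i) (skip_lt _ _ _ Hlt)). unfold tau' in Ht'.
      destruct (Nat.eq_dec (skip p i) p) as [e0|_]; [destruct (skip_neq p i e0)|].
      rewrite unskip_skip in Ht'. assumption.
    + apply Nat.le_trans with D; [|lia]. apply (IH (S n) V). intros tau Ht. apply Hi.
      intros j Hj. destruct (Nat.eq_dec j D) as [->|]; [|apply Ht; lia].
      apply sumR_eq0. intros i Hlt. destruct (Req_dec (V i D) 0) as [->|]; [ring|].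
      exfalso. apply Hno. exists i. split; [lia|assumption].
Qed.

(** The ratio test of the simplex method: [lam p / tau p] is the largest multiple of [tau] that can
    be subtracted from [lam] while keeping it nonnegative. *)
Lemma min_ratio n (lam tau : nat -> R) :
  (exists i, (i < n)%nat /\ 0 < tau i) ->
  exists p, (p < n)%nat /\ 0 < tau p /\
    forall i, (i < n)%nat -> 0 < tau i -> lam p / tau p <= lam i / tau i.
Proof.
  induction n as [|n IH]; intros (i & Hi & Ht); [lia|].
  destruct (classic (exists i, (i < n)%nat /\ 0 < tau i)) as [He|Hno].
  - destruct (IH He) as (p & Hp & Htp & Hmin).
    destruct (classic (0 < tau n /\ lam n / tau n <= lam p / tau p)) as [[H1 H2]|H].
    + exists n. split; [lia|]. split; [assumption|]. intros k Hk Hkt.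
      destruct (Nat.eq_dec k n) as [->|]; [lra|].
      specialize (Hmin k ltac:(lia) Hkt). lra.
    + exists p. split; [lia|]. split; [assumption|]. intros k Hk Hkt.
      destruct (Nat.eq_dec k n) as [->|]; [|apply Hmin; [lia|assumption]].
      apply Rnot_lt_le. intros Hlt. apply H. split; [assumption|lra].
  - assert (En : i = n).
    { destruct (Nat.eq_dec i n); [assumption|]. exfalso. apply Hno. exists i.
      split; [lia|assumption]. }
    subst i. exists n. split; [lia|]. split; [assumption|]. intros k Hk Hkt.
    destruct (Nat.eq_dec k n) as [->|]; [lra|]. exfalso. apply Hno. exists k.
    split; [lia|assumption].
Qed.

(** As long as the vectors are dependent, subtracting the largest admissible multiple of a
    dependency annihilates one coefficient, whose vector is then deleted. Positivity is recorded for
    the original [lam] at the surviving indices, since complementary slackness refers to [lam]. *)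
Lemma caratheodory D : forall n V lam,
  (forall i, (i < n)%nat -> 0 <= lam i) ->
  exists k sigma beta,
    (forall i, (i < k)%nat -> (sigma i < n)%nat /\ 0 < lam (sigma i)) /\
    (forall i, (i < k)%nat -> 0 <= beta i) /\
    (forall j, (j < D)%nat ->
       sumR k (fun i => beta i * V (sigma i) j) = sumR n (fun i => lam i * V i j)) /\
    independent D k (fun i => V (sigma i)).
Proof.
  induction n as [|n IH]; intros V lam Hl.
  - exists O, (fun i => i), lam. repeat split; auto; try (intros; lia).
    intros tau _ i Hi. lia.
  - destruct (classic (exists p, (p < S n)%nat /\ lam p = 0)) as [(p & Hp & Hp0)|Hlz].
    { destruct (IH (fun i => V (skip p i)) (fun i => lam (skip p i)))
        as (k & sigma & beta & Hs & Hb & He & Hind).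
      { intros i Hi. apply Hl, skip_lt, Hi. }
      exists k, (fun i => skip p (sigma i)), beta. repeat split; auto.
      - apply skip_lt, Hs; assumption.
      - apply Hs; assumption.
      - intros j Hj. rewrite He, (sumR_skip n p) by (assumption || lia). rewrite Hp0. ring. }
    assert (Hl0 : forall i, (i < S n)%nat -> 0 < lam i).
    { intros i Hi. destruct (Rle_lt_or_eq_dec 0 (lam i) (Hl i Hi)) as [|E]; [assumption|].
      exfalso. apply Hlz. eauto. }
    destruct (classic (independent D (S n) V)) as [Hi|Hdep].
    { exists (S n), (fun i => i), lam. repeat split; auto. }
    assert (Hpos : exists tau,
      (forall j, (j < D)%nat -> sumR (S n) (fun i => tau i * V i j) = 0) /\
      exists i, (i < S n)%nat /\ 0 < tau i).
    { apply not_all_ex_not in Hdep. destruct Hdep as [tau Hdep].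
      apply imply_to_and in Hdep. destruct Hdep as [Ht Hdep].
      apply not_all_ex_not in Hdep. destruct Hdep as [i Hdep].
      apply imply_to_and in Hdep. destruct Hdep as [Hi Hnz].
      destruct (Rlt_le_dec 0 (tau i)) as [Hp|Hn].
      - exists tau. eauto.
      - exists (fun i => -1 * tau i). split; [|exists i; split; [assumption|lra]].
        intros j Hj. rewrite (sumR_ext _ _ (fun i => -1 * (tau i * V i j))) by (intros; ring).
        rewrite sumR_scal, Ht by assumption. ring. }
    destruct Hpos as (tau & Ht & Hpos).
    destruct (min_ratio (S n) lam tau Hpos) as (p & Hp & Htp & Hmin).
    pose (r := lam p / tau p).
    assert (Hr : 0 <= r).
    { unfold r. apply Rmult_le_pos; [apply Hl, Hp|]. apply Rlt_le, Rinv_0_lt_compat, Htp. }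
    pose (lam' := fun i => lam i - r * tau i).
    assert (Hl' : forall i, (i < S n)%nat -> 0 <= lam' i).
    { intros i Hi. unfold lam'. specialize (Hl i Hi).
      destruct (Rlt_le_dec 0 (tau i)) as [Hti|Hti]; [|nra].
      specialize (Hmin i Hi Hti). fold r in Hmin.
      apply (Rmult_le_compat_r (tau i)) in Hmin; [|lra].
      unfold Rdiv in Hmin. rewrite Rmult_assoc, Rinv_l in Hmin by lra. lra. }
    assert (Hp0 : lam' p = 0) by (unfold lam', r; field; lra).
    destruct (IH (fun i => V (skip p i)) (fun i => lam' (skip p i)))
      as (k & sigma & beta & Hs & Hb & He & Hind).
    { intros i Hi. apply Hl', skip_lt, Hi. }
    exists k, (fun i => skip p (sigma i)), beta. repeat split; auto.
    + apply skip_lt, Hs; assumption.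
    + apply Hl0, skip_lt, Hs; assumption.
    + intros j Hj. rewrite He by assumption.
      assert (E : sumR (S n) (fun i => lam' i * V i j) = sumR (S n) (fun i => lam i * V i j)).
      { rewrite (sumR_ext _ _ (fun i => 1 * (lam i * V i j) + (- r) * (tau i * V i j)))
          by (intros; unfold lam'; ring).
        rewrite sumR_lin, Ht by assumption. ring. }
      rewrite <- E, (sumR_skip n p) by lia. rewrite Hp0. ring.
Qed.

(** * The optimal adjoint and the normal fan *)

(** Maximizing the adjoint parameter is a linear program in dimension [d + 1] with constraint
    normals [(a i, 1)]. Complementary slackness makes the constraints with positive multiplier tight
    at [x], and Caratheodory reduces them to independent ones. The final clause is this
    independence: a relation among the chosen [a i] is determined by its total weight. *)
Lemma qcd_circuit d n a b q :
  is_qcd d n a b q ->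
  exists x k sigma beta,
    (forall i, (i < n)%nat -> dot d (a i) x <= b i - / q) /\
    (k <= S d)%nat /\
    (forall i, (i < k)%nat ->
       (sigma i < n)%nat /\ dot d (a (sigma i)) x = b (sigma i) - / q) /\
    (forall i, (i < k)%nat -> 0 <= beta i) /\
    sumR k beta = 1 /\
    (forall j, (j < d)%nat -> sumR k (fun i => beta i * IZR (a (sigma i) j)) = 0) /\
    (forall tau, (forall j, (j < d)%nat -> sumR k (fun i => tau i * IZR (a (sigma i) j)) = 0) ->
       sumR k tau = 0 -> forall i, (i < k)%nat -> tau i = 0).
Proof.
  intros (Hq & [x Hx] & Hmax).
  assert (Hc : 0 < / q) by (apply Rinv_0_lt_compat, Hq).
  (* the last coordinate plays the role of the adjoint parameter *)
  pose (A := fun i j => if Nat.eq_dec j d then 1 else IZR (a i j)).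
  assert (Ad : forall i, A i d = 1).
  { intros i. unfold A. destruct (Nat.eq_dec d d); congruence. }
  assert (Aj : forall i j, (j < d)%nat -> A i j = IZR (a i j)).
  { intros i j Hj. unfold A. destruct (Nat.eq_dec j d); [lia|reflexivity]. }
  assert (HA : forall i z, dotR (S d) (A i) z = dot d (a i) z + z d).
  { intros i z. unfold dotR, dot. simpl. rewrite Ad. rewrite Rmult_1_l. f_equal.
    apply sumR_ext. intros j Hj. rewrite Aj by assumption. reflexivity. }
  assert (Gd : forall z, dotR (S d) (unitv d) z = z d)
    by (intros; apply dotR_unitv_l; lia).
  pose (xc := fun j => if Nat.eq_dec j d then / q else x j).
  assert (xcd : xc d = / q) by (unfold xc; destruct (Nat.eq_dec d d); congruence).
  assert (xcj : forall i, dot d (a i) xc = dot d (a i) x).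
  { intros i. apply sumR_ext. intros j Hj. unfold xc.
    destruct (Nat.eq_dec j d); [lia|reflexivity]. }
  assert (Hxc : polyh (S d) n A b xc).
  { intros i Hi. rewrite HA, xcd, xcj. specialize (Hx i Hi). lra. }
  destruct (lp_duality (S d) n A b (unitv d) (/ q)) as (lam & Hl & Hla & Hlb).
  { eauto. }
  (* [Hmax] speaks of positive parameters only; the remaining ones are below [/ q] anyway. *)
  { intros z Hz. rewrite Gd. destruct (Rlt_le_dec 0 (z d)) as [Hp|]; [|lra].
    apply Hmax; [assumption|]. exists z. intros i Hi. specialize (Hz i Hi).
    rewrite HA in Hz. lra. }
  (* Complementary slackness: the terms are nonnegative and their sum is at most [/ q - / q]. *)
  assert (Hslack : forall i, (i < n)%nat -> lam i * (b i - dotR (S d) (A i) xc) = 0).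
  { apply sumR_nonneg_eq0.
    - intros i Hi. apply Rmult_le_pos; [auto|]. specialize (Hxc i Hi). lra.
    - rewrite (sumR_ext n _ (fun i => lam i * b i - lam i * dotR (S d) (A i) xc))
        by (intros; ring).
      rewrite sumR_minus, dotR_sum.
      replace (dotR (S d) (fun j => sumR n (fun i => lam i * A i j)) xc) with (/ q); [lra|].
      rewrite <- xcd, <- (Gd xc). apply sumR_ext. intros j Hj. rewrite Hla by assumption.
      reflexivity. }
  destruct (caratheodory (S d) n A lam Hl) as (k & sigma & beta & Hs & Hb & He & Hind).
  exists x, k, sigma, beta. split; [assumption|]. split; [|split; [|split; [|split; [|split]]]].
  - apply (independent_card (S d) k _ Hind).
  - intros i Hi. destruct (Hs i Hi) as [Hsi Hpos]. split; [assumption|].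
    specialize (Hslack _ Hsi). rewrite HA, xcd, xcj in Hslack.
    apply Rmult_integral in Hslack. lra.
  - assumption.
  - rewrite (sumR_ext k beta (fun i => beta i * A (sigma i) d)) by (intros; rewrite Ad; ring).
    rewrite He, <- Hla by lia. unfold unitv. destruct (Nat.eq_dec d d); congruence.
  - intros j Hj.
    rewrite (sumR_ext k _ (fun i => beta i * A (sigma i) j))
      by (intros; rewrite Aj by assumption; ring).
    rewrite He, <- Hla by lia. unfold unitv. destruct (Nat.eq_dec j d); [lia|reflexivity].
  - intros tau Ht Hsum. apply Hind. intros j Hj. destruct (Nat.eq_dec j d) as [->|].
    + rewrite <- Hsum. apply sumR_ext. intros; rewrite Ad; ring.
    + rewrite <- (Ht j) by lia. apply sumR_ext. intros. rewrite Aj by lia. reflexivity.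
Qed.

(** A maximizer [v] of [y] exists by boundedness, and complementary slackness confines the dual
    multipliers of [y] to the constraints tight at [v]. *)
Lemma normal_fan_complete d n a b (y : nat -> R) :
  Defs.bounded d n a b -> (exists x, inP d n a b x) ->
  exists v, inP d n a b v /\ in_cone d n a (tight d n a b v) y.
Proof.
  intros [B HB] Hne. pose (A := fun i j => IZR (a i j)).
  destruct (lp_attained d n A b y (sumR d (fun j => Rabs (y j) * B))) as (v & Hv & Hmax).
  { exact Hne. }
  { intros x Hx. apply sumR_le. intros j Hj. specialize (HB x Hx j Hj).
    apply Rle_trans with (Rabs (y j * x j)); [apply Rle_abs|]. rewrite Rabs_mult.
    apply Rmult_le_compat_l; [apply Rabs_pos|assumption]. }
  destruct (lp_duality d n A b y (dotR d y v) Hne Hmax) as (lam & Hl & Hla & Hlb).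
  exists v. split; [exact Hv|]. exists lam. split; [assumption|]. split; [|exact Hla].
  assert (Hslack : forall i, (i < n)%nat -> lam i * (b i - dotR d (A i) v) = 0).
  { apply sumR_nonneg_eq0.
    - intros i Hi. apply Rmult_le_pos; [auto|]. specialize (Hv i Hi). lra.
    - rewrite (sumR_ext n _ (fun i => lam i * b i - lam i * dotR d (A i) v)) by (intros; ring).
      rewrite sumR_minus, dotR_sum.
      replace (dotR d (fun j => sumR n (fun i => lam i * A i j)) v) with (dotR d y v); [lra|].
      apply sumR_ext. intros j Hj. rewrite Hla by assumption. reflexivity. }
  intros i Hi Ht. specialize (Hslack i Hi). apply Rmult_integral in Hslack.
  destruct Hslack as [|E]; [assumption|]. exfalso. apply Ht.
  unfold tight. change (dotR d (A i) v = b i). lra.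
Qed.

(* For a vertex [v] whose normal cone contains [y = sum mu_i a_i] with height [h], compare
   [<y,x>] computed from both representations: [sum mu_i b_i - c sum mu_i = <y,x>
   <= <y,v> - c h <= sum mu_i b_i - c h], so the height is at most the total weight [mu]. *)
Lemma small_core_combination_zero d n a b alpha c x k sigma mu (y : nat -> Z) :
  Defs.bounded d n a b -> (exists x, inP d n a b x) -> alpha_canonical_fan d n a b alpha ->
  0 < c -> (forall i, (i < n)%nat -> dot d (a i) x <= b i - c) ->
  (forall i, (i < k)%nat -> (sigma i < n)%nat /\ dot d (a (sigma i)) x = b (sigma i) - c) ->
  (forall i, (i < k)%nat -> 0 <= mu i) ->
  (forall j, (j < d)%nat -> IZR (y j) = sumR k (fun i => mu i * IZR (a (sigma i) j))) ->
  sumR k mu < alpha ->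
  forall j, (j < d)%nat -> y j = 0%Z.
Proof.
  intros Hbd Hne Hfan Hc Hx Hs Hmu Hy Hsum. apply NNPP. intros Hno.
  assert (Hnz : exists j, (j < d)%nat /\ y j <> 0%Z).
  { apply NNPP. intros H. apply Hno. intros j Hj. apply NNPP. intros Hj0. apply H. eauto. }
  destruct (normal_fan_complete d n a b (fun j => IZR (y j)) Hbd Hne) as (v & Pv & Cv).
  destruct (Hfan v Pv y Hnz Cv) as (h & [(nu & (Hnu & Hnut & Hnuy) & Hnus) _] & Hah).
  pose (A := fun i j => IZR (a i j)). pose (Y := fun j => IZR (y j)).
  assert (Ynu : forall z, dotR d Y z = sumR n (fun i => nu i * dotR d (A i) z)).
  { intros z. rewrite dotR_sum. apply sumR_ext. intros j Hj.
    f_equal. apply Hnuy, Hj. }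
  assert (Ymu : forall z, dotR d Y z = sumR k (fun i => mu i * dotR d (A (sigma i)) z)).
  { intros z. rewrite (dotR_sum d k mu (fun i => A (sigma i))). apply sumR_ext. intros j Hj.
    f_equal. apply Hy, Hj. }
  assert (E1 : dotR d Y x = sumR k (fun i => mu i * b (sigma i)) - c * sumR k mu).
  { rewrite Ymu, <- sumR_scal, <- sumR_minus. apply sumR_ext. intros i Hi.
    destruct (Hs i Hi) as [_ E]. change (dotR d (A (sigma i)) x = b (sigma i) - c) in E.
    rewrite E. ring. }
  assert (E2 : dotR d Y x <= dotR d Y v - c * h).
  { rewrite !Ynu, <- Hnus, <- sumR_scal, <- sumR_minus. apply sumR_le. intros i Hi.
    specialize (Hx i Hi). change (dotR d (A i) x <= b i - c) in Hx. specialize (Hnu i Hi).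
    destruct (classic (tight d n a b v i)) as [Ht|Ht].
    - change (dotR d (A i) v = b i) in Ht. rewrite Ht. nra.
    - rewrite (Hnut i Hi Ht). lra. }
  assert (E3 : dotR d Y v <= sumR k (fun i => mu i * b (sigma i))).
  { rewrite Ymu. apply sumR_le. intros i Hi. destruct (Hs i Hi) as [Hsi _].
    apply Rmult_le_compat_l; [auto|]. apply (Pv _ Hsi). }
  nra.
Qed.
(** * Weights admitting no good one-sided approximation *)

(** The arithmetic form in which canonicity is used: a one-sided approximation of total error below
    [alpha] must be exactly proportional to [beta]. A real scale [T] leaves room to shift a
    two-sided approximation into a one-sided one. *)
Definition badly_approximable (k : nat) (alpha : R) (beta : nat -> R) : Prop :=
  forall (T : R) (N : nat -> Z),
    (forall i, (i < k)%nat -> 0 <= T * beta i - IZR (N i)) ->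
    sumR k (fun i => T * beta i - IZR (N i)) < alpha ->
    forall i, (i < k)%nat -> IZR (N i) = sumR k (fun i => IZR (N i)) * beta i.

Lemma Int_part_IZR z : Int_part (IZR z) = z.
Proof. symmetry. apply Int_part_spec. lra. Qed.

(** * Dirichlet approximation *)

Lemma nearest_integer r : exists z, Rabs (r - IZR z) <= 1 / 2.
Proof.
  exists (up (r - 1 / 2)). destruct (archimed (r - 1 / 2)). apply Rabs_le. lra.
Qed.

(** The error is halved at each step by multiplying [m] with a suitable bounded [j]. The bound [M]
    is independent of [r], which the simultaneous version relies on. *)
Lemma dirichlet_uniform e : exists M : nat, forall r, exists (m : nat) (z : Z),
  (1 <= m <= M)%nat /\ Rabs (INR m * r - IZR z) <= (1 / 2) ^ e.
Proof.
  induction e as [|e [M HM]].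
  - exists 1%nat. intros r. destruct (nearest_integer r) as [z Hz].
    exists 1%nat, z. split; [lia|]. simpl. rewrite Rmult_1_l. lra.
  - set (dl := (1 / 2) ^ e) in *.
    assert (Hdl : 0 < dl) by (apply pow_lt; lra).
    change ((1 / 2) ^ S e) with (1 / 2 * dl).
    (* A bound for [j]: it is used only if [th] exceeds [dl / 2], so [/ th] is below [2 / dl], and
       rounding adds at most one half. *)
    pose (K := up (2 / dl + 1)). destruct (archimed (2 / dl + 1)) as [HK _]. fold K in HK.
    exists (M * (1 + Z.to_nat K))%nat. intros r.
    destruct (HM r) as (m & z & Hm & Hz).
    destruct (Rle_lt_dec (Rabs (INR m * r - IZR z)) (1 / 2 * dl)) as [Hle|Hgt].
    + exists m, z. split; [nia|assumption].
    + set (th := Rabs (INR m * r - IZR z)) in *.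
      (* a multiple [j] of the error [th] is within [th / 2] of [1] *)
      destruct (nearest_integer (/ th)) as [j Hj].
      assert (Hth : 0 < th) by lra.
      assert (Hdl1 : dl <= 1).
      { apply Rle_trans with (1 ^ e); [apply pow_incr; lra|rewrite pow1; lra]. }
      assert (Hinv1 : 1 <= / th).
      { rewrite <- Rinv_1. apply Rinv_le_contravar; lra. }
      assert (Hinv2 : / th <= 2 / dl).
      { replace (2 / dl) with (/ (1 / 2 * dl)) by (field; lra).
        apply Rinv_le_contravar; lra. }
      assert (Hj2 : - (1 / 2) <= / th - IZR j <= 1 / 2).
      { unfold Rabs in Hj; destruct (Rcase_abs _); lra. }
      assert (Hj1 : (1 <= j)%Z) by (apply Z.lt_pred_le, lt_IZR; simpl; lra).
      assert (HjK : (j < K)%Z) by (apply lt_IZR; lra).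
      assert (Hjn : INR (Z.to_nat j) = IZR j).
      { rewrite INR_IZR_INZ, Z2Nat.id by lia. reflexivity. }
      assert (Hjt : Rabs (IZR j * th - 1) <= 1 / 2 * dl).
      { replace (IZR j * th - 1) with (- (th * (/ th - IZR j))) by (field; lra).
        rewrite Rabs_Ropp, Rabs_mult, (Rabs_right th) by lra. nra. }
      (* [th] is an absolute value, so [j] times the signed error is close to [1] or to [-1]; [s] is
         that sign. *)
      assert (Hsg : exists s : Z, IZR j * (INR m * r - IZR z) - IZR s = IZR j * th - 1
                   \/ IZR j * (INR m * r - IZR z) - IZR s = - (IZR j * th - 1)).
      { unfold th, Rabs. destruct (Rcase_abs _); [exists (-1)%Z; right|exists 1%Z; left]; ring. }
      destruct Hsg as [s Hsg].
      exists (Z.to_nat j * m)%nat, (j * z + s)%Z. split.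
      * assert (Z.to_nat j <= Z.to_nat K)%nat by lia.
        assert (1 <= Z.to_nat j)%nat by lia. nia.
      * rewrite mult_INR, plus_IZR, mult_IZR, Hjn.
        replace (IZR j * INR m * r - (IZR j * IZR z + IZR s)) with
          (IZR j * (INR m * r - IZR z) - IZR s) by ring.
        destruct Hsg as [->| ->]; [|rewrite Rabs_Ropp]; assumption.
Qed.

(** The first [k] entries are approximated to within [dl / INR M] by [m0]; a factor [m] of size at
    most [M] then repairs entry [k] and enlarges the earlier errors at most [M] times. [M] has to be
    fixed before [m0] is known. *)
Lemma dirichlet_simultaneous k : forall (dl : R) (p : nat -> R), 0 < dl ->
  exists (m : nat) (N : nat -> Z), (1 <= m)%nat /\
    forall i, (i < k)%nat -> Rabs (INR m * p i - IZR (N i)) <= dl.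
Proof.
  induction k as [|k IH]; intros dl p Hdl.
  - exists 1%nat, (fun _ => 0%Z). split; [lia|intros; lia].
  - destruct (pow_lt_1_zero (1 / 2)) with (y := dl) as [e He]; auto.
    { rewrite Rabs_right; lra. }
    specialize (He e (Nat.le_refl e)).
    rewrite Rabs_right in He by (apply Rle_ge, pow_le; lra).
    destruct (dirichlet_uniform e) as [M HM].
    assert (HM1 : 1 <= INR M).
    { destruct (HM 0) as (m & z & Hm & _). apply (le_INR 1). lia. }
    destruct (IH (dl / INR M) p) as (m0 & N0 & Hm0 & H0).
    { apply Rdiv_lt_0_compat; lra. }
    destruct (HM (INR m0 * p k)) as (m & z & Hm & Hz).
    exists (m * m0)%nat, (fun i => if Nat.eq_dec i k then z else (Z.of_nat m * N0 i)%Z).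
    split; [nia|]. intros i Hi. rewrite mult_INR. destruct (Nat.eq_dec i k) as [->|].
    + rewrite Rmult_assoc. lra.
    + rewrite mult_IZR, <- INR_IZR_INZ.
      replace (INR m * INR m0 * p i - INR m * IZR (N0 i)) with
        (INR m * (INR m0 * p i - IZR (N0 i))) by ring.
      assert (Hmp : 0 <= INR m) by apply pos_INR.
      assert (HmM : INR m <= INR M) by (apply le_INR; lia).
      rewrite Rabs_mult, (Rabs_right (INR m)) by lra.
      specialize (H0 i ltac:(lia)).
      replace dl with (INR M * (dl / INR M)) by (field; lra).
      assert (0 <= Rabs (INR m0 * p i - IZR (N0 i))) by apply Rabs_pos.
      apply Rmult_le_compat; assumption.
Qed.

Lemma positive_entries_bound k (p : nat -> R) :
  (forall i, (i < k)%nat -> 0 <= p i) ->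
  exists m, 0 < m <= 1 /\ forall i, (i < k)%nat -> p i = 0 \/ m <= p i.
Proof.
  induction k as [|k IH]; intros Hp.
  - exists 1. split; [lra|intros; lia].
  - destruct IH as (m & Hm & H); [intros; apply Hp; lia|].
    destruct (Req_dec (p k) 0) as [E|E].
    + exists m. split; [assumption|]. intros i Hi. destruct (Nat.eq_dec i k) as [->|]; [auto|].
      apply H; lia.
    + assert (0 <= p k) by (apply Hp; lia).
      exists (Rmin m (p k)). assert (H1 := Rmin_l m (p k)). assert (H2 := Rmin_r m (p k)).
      split; [split; [apply Rmin_pos; lra|lra]|].
      intros i Hi. destruct (Nat.eq_dec i k) as [->|]; [auto|].
      destruct (H i ltac:(lia)); [auto|right; lra].
Qed.

(* Shifting the Dirichlet approximation [m p ~ N] by a small positive multiple of [p] makes it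
   one-sided at every positive entry of [p]; vanishing entries are one-sided because [N i = 0]
   there and [beta i >= 0].  This is why entries tending to [0] do no harm. *)
Lemma badly_approximable_locally_unique k alpha (p : nat -> R) :
  0 < alpha -> (forall i, (i < k)%nat -> 0 <= p i <= 1) ->
  exists eta, 0 < eta /\ exists N : nat -> Z, forall beta,
    ((forall i, (i < k)%nat -> 0 <= beta i) /\ sumR k beta = 1 /\
     badly_approximable k alpha beta) ->
    (forall i, (i < k)%nat -> Rabs (beta i - p i) < eta) ->
    sumR k (fun i => IZR (N i)) <> 0 /\
    forall i, (i < k)%nat -> IZR (N i) = sumR k (fun i => IZR (N i)) * beta i.
Proof.
  intros Ha Hp.
  assert (Hk : 0 <= INR k) by apply pos_INR.
  destruct (classic (exists i, (i < k)%nat /\ p i <> 0)) as [(i0 & Hi0 & Hnz)|Hz].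
  (* No weight of total [1] is this close to the zero vector. *)
  2:{ exists (/ (INR k + 1)). split; [apply Rinv_0_lt_compat; lra|].
      exists (fun _ => 0%Z). intros beta (Hb & Hs & _) Hnear. exfalso.
      assert (sumR k beta <= sumR k (fun _ => / (INR k + 1))).
      { apply sumR_le. intros i Hi. specialize (Hnear i Hi).
        assert (E : p i = 0) by (apply NNPP; intros E; apply Hz; eauto).
        rewrite E, Rminus_0_r in Hnear. assert (H := Rle_abs (beta i)). lra. }
      rewrite sumR_const in H.
      assert (INR k * / (INR k + 1) < 1).
      { apply Rmult_lt_reg_r with (INR k + 1); [lra|].
        rewrite Rmult_assoc, Rinv_l by lra. lra. }
      lra. }
  destruct (positive_entries_bound k p) as (m0 & Hm0 & Hmin); [intros; apply Hp; assumption|].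
  (* Each error will be at most [C * dl]: [dl] from Dirichlet, [dl] from the distance of [beta] to
     [p], and [2 * dl / m0] from the shift. The factor [INR k + 1] in [dl] brings the total strictly
     below [alpha]. *)
  set (C := 2 + 2 / m0).
  assert (Him : 0 < 2 / m0) by (apply Rdiv_lt_0_compat; lra).
  assert (HkC : 0 < (INR k + 1) * C) by (apply Rmult_lt_0_compat; unfold C; lra).
  set (dl := Rmin (m0 / 2) (alpha / ((INR k + 1) * C))).
  assert (Hdl : 0 < dl).
  { apply Rmin_pos; [lra|]. apply Rdiv_lt_0_compat; lra. }
  assert (Hdl1 : dl <= m0 / 2) by apply Rmin_l.
  assert (Hdl2 : (INR k + 1) * C * dl <= alpha).
  { replace alpha with ((INR k + 1) * C * (alpha / ((INR k + 1) * C)))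
      by (field; unfold C in *; split; lra).
    apply Rmult_le_compat_l; [lra|apply Rmin_r]. }
  destruct (dirichlet_simultaneous k dl p Hdl) as (m & N0 & Hm & HN0).
  assert (Hm1 : 1 <= INR m) by (apply (le_INR 1); lia).
  pose (N := fun i => if Req_EM_T (p i) 0 then 0%Z else N0 i).
  (* On entries [p i >= m0] the shift contributes at least [2 * dl], outweighing both two-sided
     errors. *)
  pose (T := INR m + 2 * dl / m0).
  assert (Hq : 0 < 2 * dl / m0) by (apply Rdiv_lt_0_compat; lra).
  assert (HT : 0 < T) by (unfold T; lra).
  exists (dl / T). split; [apply Rdiv_lt_0_compat; assumption|].
  exists N. intros beta (Hb & Hs & Hbad) Hnear.
  assert (Hbnd : forall i, (i < k)%nat -> 0 <= T * beta i - IZR (N i) <= C * dl).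
  { intros i Hi. specialize (Hnear i Hi). specialize (Hb i Hi). specialize (Hp i Hi).
    assert (Hd : Rabs (T * beta i - T * p i) < dl).
    { replace (T * beta i - T * p i) with (T * (beta i - p i)) by ring.
      rewrite Rabs_mult, (Rabs_right T) by lra.
      replace dl with (T * (dl / T)) by (field; lra).
      apply Rmult_lt_compat_l; assumption. }
    apply Rabs_def2 in Hd.
    assert (HC : C * dl = 2 * dl + 2 * dl / m0) by (unfold C; field; lra).
    unfold N. destruct (Req_EM_T (p i) 0) as [E|E].
    - rewrite E in Hd. nra.
    - specialize (HN0 i Hi).
      assert (Hn : - dl <= INR m * p i - IZR (N0 i) <= dl)
        by (unfold Rabs in HN0; destruct (Rcase_abs _); lra).
      destruct (Hmin i Hi) as [|Hge]; [contradiction|].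
      assert (H1 : 2 * dl / m0 * m0 <= 2 * dl / m0 * p i) by (apply Rmult_le_compat_l; lra).
      assert (H2 : 2 * dl / m0 * p i <= 2 * dl / m0 * 1) by (apply Rmult_le_compat_l; lra).
      replace (2 * dl / m0 * m0) with (2 * dl) in H1 by (field; lra).
      assert (HTp : T * p i = INR m * p i + 2 * dl / m0 * p i) by (unfold T; ring).
      lra. }
  assert (HN : forall i, (i < k)%nat -> IZR (N i) = sumR k (fun i => IZR (N i)) * beta i).
  { apply (Hbad T N); [intros; apply Hbnd; assumption|].
    apply Rle_lt_trans with (sumR k (fun _ => C * dl)).
    - apply sumR_le. intros; apply Hbnd; assumption.
    - rewrite sumR_const. assert (0 < C * dl); [|lra].
      apply Rmult_lt_0_compat; [unfold C; lra|assumption]. }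
  (* A zero sum would force [N i0 = 0], hence [INR m * p i0 <= dl <= m0 / 2], although
     [p i0 >= m0]. *)
  split; [|assumption]. intros HS.
  specialize (HN i0 Hi0). rewrite HS, Rmult_0_l in HN. unfold N in HN.
  destruct (Req_EM_T (p i0) 0); [contradiction|].
  specialize (HN0 i0 Hi0). rewrite HN, Rminus_0_r in HN0.
  assert (H := Rle_abs (INR m * p i0)).
  destruct (Hmin i0 Hi0); [contradiction|]. nra.
Qed.

(** * Compactness of the cube *)

Lemma positive_lower_bound (X : Type) (l : list (X * R)) :
  exists e, 0 < e /\ forall x r, In (x, r) l -> 0 < r -> e <= r.
Proof.
  induction l as [|[x r] l (e & He & H)].
  - exists 1. split; [lra|]. intros x r [].
  - destruct (Rlt_le_dec 0 r) as [Hr|Hr].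
    + exists (Rmin e r). assert (H1 := Rmin_l e r). assert (H2 := Rmin_r e r).
      split; [apply Rmin_pos; assumption|]. intros x' r' [E|Hin] Hr'.
      * injection E as -> ->. assumption.
      * specialize (H x' r' Hin Hr'). lra.
    + exists e. split; [assumption|]. intros x' r' [E|Hin] Hr'.
      * injection E as -> ->. lra.
      * eauto.
Qed.

(** Heine-Borel by suprema: let [m] be the supremum of those [s] for which finitely many labels
    serve all [y] with [f y <= s]. The local list at [m] extends past [m] unless [1] is reached. *)
Lemma interval_compact (Y X : Type) (B : Y -> Prop) (f : Y -> R) (Rel : Y -> X -> Prop) :
  (forall y, B y -> 0 <= f y <= 1) ->
  (forall t, 0 <= t <= 1 -> exists dl, 0 < dl /\ exists l : list X,
     forall y, B y -> Rabs (f y - t) < dl -> exists x, In x l /\ Rel y x) ->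
  exists l : list X, forall y, B y -> exists x, In x l /\ Rel y x.
Proof.
  intros Hf Hloc.
  pose (E s := s <= 1 /\ exists l : list X,
    forall y, B y -> f y <= s -> exists x, In x l /\ Rel y x).
  assert (E0 : E 0).
  { split; [lra|]. destruct (Hloc 0) as (dl & Hdl & l & Hl); [lra|]. exists l.
    intros y By Hy. apply Hl; [assumption|]. specialize (Hf y By).
    replace (f y - 0) with 0 by lra. rewrite Rabs_R0. assumption. }
  destruct (completeness E) as [m [Hub Hlub]].
  { exists 1. intros s [Hs _]. assumption. }
  { exists 0. assumption. }
  assert (Hm0 : 0 <= m) by (apply Hub, E0).
  assert (Hm1 : m <= 1) by (apply Hlub; intros s [Hs _]; assumption).
  destruct (Hloc m) as (dl & Hdl & l & Hl); [lra|].
  assert (Hs : exists s, E s /\ m - dl < s).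
  { apply NNPP. intros Hno. assert (m <= m - dl); [|lra]. apply Hlub. intros s Es.
    apply Rnot_lt_le. intros Hlt. apply Hno. eauto. }
  destruct Hs as (s & [Hs1 [ls Hls]] & Hsm).
  assert (Em : E (Rmin 1 (m + dl / 2))).
  { split; [apply Rmin_l|]. exists (ls ++ l). intros y By Hy.
    assert (H := Rmin_r 1 (m + dl / 2)).
    destruct (Rle_lt_dec (f y) s) as [Hle|Hgt].
    - destruct (Hls y By Hle) as (x & Hin & Hx). exists x. split; [|assumption].
      apply in_or_app. auto.
    - destruct (Hl y By) as (x & Hin & Hx); [apply Rabs_def1; lra|].
      exists x. split; [|assumption]. apply in_or_app. auto. }
  assert (Hle := Hub _ Em).
  destruct (Rle_lt_dec 1 (m + dl / 2)) as [H1|H1].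
  - rewrite Rmin_left in Em by assumption. destruct Em as [_ [l1 H]]. exists l1.
    intros y By. apply H; [assumption|]. apply Hf, By.
  - rewrite Rmin_right in Hle by lra. lra.
Qed.

(** The tube lemma, by induction on the dimension: the slice over [t] is covered by finitely many
    labels, each paired with its radius in the last coordinate, and the least positive radius gives
    a slab around the slice. *)
Lemma cube_compact (B : (nat -> R) -> Prop) k : forall (X : Type) (Rel : (nat -> R) -> X -> Prop),
  (forall y, B y -> forall i, (i < k)%nat -> 0 <= y i <= 1) ->
  (forall p, (forall i, (i < k)%nat -> 0 <= p i <= 1) ->
     exists dl, 0 < dl /\ exists x, forall y, B y ->
       (forall i, (i < k)%nat -> Rabs (y i - p i) < dl) -> Rel y x) ->
  exists l : list X, forall y, B y -> exists x, In x l /\ Rel y x.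
Proof.
  induction k as [|k IH]; intros X Rel HB Hloc.
  - destruct (Hloc (fun _ => 0)) as (dl & _ & x & H); [intros; lia|].
    exists (x :: nil). intros y By. exists x. split; [left; reflexivity|].
    apply H; [assumption|intros; lia].
  - apply (interval_compact _ _ B (fun y => y k) Rel).
    { intros y By. apply HB; [assumption|lia]. }
    intros t Ht.
    destruct (IH (X * R)%type
      (fun y xr => 0 < snd xr /\ (Rabs (y k - t) < snd xr -> Rel y (fst xr)))) as [l Hl].
    + intros y By i Hi. apply HB; [assumption|lia].
    + intros p Hp.
      destruct (Hloc (fun i => if Nat.eq_dec i k then t else p i)) as (dl & Hdl & x & H).
      { intros i Hi. destruct (Nat.eq_dec i k); [assumption|apply Hp; lia]. }
      exists dl. split; [assumption|]. exists (x, dl). intros y By Hnear. simpl.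
      split; [assumption|]. intros Hk. apply H; [assumption|]. intros i Hi.
      destruct (Nat.eq_dec i k) as [->|]; [assumption|apply Hnear; lia].
    + destruct (positive_lower_bound X l) as (e & He & Hle).
      exists e. split; [assumption|]. exists (map fst l). intros y By Hy.
      destruct (Hl y By) as ([x r] & Hin & Hr & Hx). simpl in *.
      exists x. split; [apply (in_map fst) in Hin; exact Hin|]. apply Hx.
      specialize (Hle x r Hin Hr). lra.
Qed.

(** Since the sum of [N] is nonzero, [N] determines [beta] as the ratio of each entry to that sum;
    thus only finitely many, rational, weights occur. *)
Lemma badly_approximable_finite k alpha :
  0 < alpha ->
  exists L : list (nat -> Z), forall beta,
    (forall i, (i < k)%nat -> 0 <= beta i) -> sumR k beta = 1 ->
    badly_approximable k alpha beta ->
    exists N, In N L /\ sumR k (fun i => IZR (N i)) <> 0 /\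
      forall i, (i < k)%nat -> IZR (N i) = sumR k (fun i => IZR (N i)) * beta i.
Proof.
  intros Ha.
  destruct (cube_compact (fun beta => (forall i, (i < k)%nat -> 0 <= beta i) /\
      sumR k beta = 1 /\ badly_approximable k alpha beta) k (nat -> Z)
    (fun beta N => sumR k (fun i => IZR (N i)) <> 0 /\
      forall i, (i < k)%nat -> IZR (N i) = sumR k (fun i => IZR (N i)) * beta i)) as [L HL].
  - intros beta (Hb & Hs & _) i Hi. split; [auto|].
    destruct k as [|k]; [lia|]. rewrite <- Hs, (sumR_skip k i) by lia.
    assert (0 <= sumR k (fun i0 => beta (skip i i0))); [|lra].
    apply sumR_nonneg. intros j Hj. apply Hb, skip_lt, Hj.
  - intros p Hp. apply badly_approximable_locally_unique; assumption.
  - exists L. intros beta Hb Hs Hbad. apply HL. auto.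
Qed.

(** * Finiteness *)

Lemma bounded_integers_finite (r : R) :
  exists l : list Z, forall z, Rabs (IZR z) <= r -> In z l.
Proof.
  pose (K := up r). destruct (archimed r) as [HK _]. fold K in HK.
  exists (map (fun m => Z.of_nat m - K)%Z (seq 0 (Z.to_nat (2 * K + 1)))). intros z Hz.
  assert (H1 := Rle_abs (IZR z)). assert (H2 := Rle_abs (- IZR z)). rewrite Rabs_Ropp in H2.
  assert (H3 : (z < K)%Z) by (apply lt_IZR; lra).
  assert (H4 : (- z < K)%Z) by (apply lt_IZR; rewrite opp_IZR; lra).
  apply in_map_iff. exists (Z.to_nat (z + K)). split; [lia|]. apply in_seq. lia.
Qed.

Lemma finite_setR_Union_list (X : Type) (S : X -> R -> Prop) (L : list X) :
  (forall x, In x L -> finite_setR (S x)) ->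
  finite_setR (fun q => exists x, In x L /\ S x q).
Proof.
  induction L as [|x L IH]; intros H.
  - exists nil. intros q (x & [] & _).
  - destruct IH as [l Hl]; [intros; apply H; right; assumption|].
    destruct (H x) as [lx Hlx]; [left; reflexivity|].
    exists (lx ++ l). intros q (x' & [<-|Hin] & Hq); apply in_or_app; eauto.
Qed.

(** Multiplied by the sum [Sm N], the value [/ q] becomes an integer of absolute value at most
    [Rabs (Sm N) / eps], so each [N] accounts for finitely many [q]. *)
Lemma weighted_codegrees_finite k alpha eps :
  0 < alpha -> 0 < eps ->
  finite_setR (fun q => eps <= q /\ exists (beta : nat -> R) (b : nat -> Z),
    (forall i, (i < k)%nat -> 0 <= beta i) /\ sumR k beta = 1 /\
    badly_approximable k alpha beta /\ / q = sumR k (fun i => beta i * IZR (b i))).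
Proof.
  intros Ha He. destruct (badly_approximable_finite k alpha Ha) as [L HL].
  pose (Sm := fun N : nat -> Z => sumR k (fun i => IZR (N i))).
  destruct (finite_setR_Union_list _
    (fun N q => eps <= q /\ Sm N <> 0 /\ exists z : Z, Sm N * / q = IZR z) L) as [l Hl].
  - intros N _. destruct (bounded_integers_finite (Rabs (Sm N) / eps)) as [lz Hlz].
    exists (map (fun z => Sm N / IZR z) lz). intros q (Hq & HS & z & Hz).
    apply in_map_iff. exists z. split.
    + rewrite <- Hz. field. split; [lra|assumption].
    + apply Hlz. rewrite <- Hz, Rabs_mult, (Rabs_right (/ q)).
      * apply Rmult_le_compat_l; [apply Rabs_pos|]. apply Rinv_le_contravar; lra.
      * apply Rle_ge, Rlt_le, Rinv_0_lt_compat. lra.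
  - exists l. intros q (Hq & beta & b & Hb & Hs & Hbad & Hqb).
    destruct (HL beta Hb Hs Hbad) as (N & Hin & HS & HN).
    apply Hl. exists N. split; [assumption|]. split; [assumption|]. split; [assumption|].
    rewrite Hqb, <- sumR_scal. apply sumR_IZR. intros i Hi. exists (N i * b i)%Z.
    rewrite mult_IZR, (HN i Hi). unfold Sm. ring.
Qed.

Theorem theorem3p1 (d : nat) (alpha eps : R) (Halpha : 0 < alpha) (Heps : 0 < eps) :
  finite_setR (fun q =>
    exists (n : nat) (a : nat -> nat -> Z) (b : nat -> R),
      lattice_polytope_desc d n a b /\
      alpha_canonical_fan d n a b alpha /\
      is_qcd d n a b q /\ eps <= q).
Proof.
  (* The support size [k] ranges over [0] to [d + 1]. *)
  destruct (finite_setR_Union_list nat _ (seq 0 (S (S d)))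
    (fun k _ => weighted_codegrees_finite k alpha eps Halpha Heps)) as [l Hl].
  exists l. intros q (n & a & b & Hpoly & Hfan & Hqcd & Hq). apply Hl.
  destruct (qcd_circuit d n a b q Hqcd) as
    (x & k & sigma & beta & Hx & Hk & Hs & Hb & Hsum & Hrel & Hind).
  exists k. split; [apply in_seq; lia|]. split; [assumption|].
  assert (Hz : exists bz : nat -> Z, forall i, (i < k)%nat -> b (sigma i) = IZR (bz i)).
  (* [Int_part] turns pointwise integrality into a function. *)
  { exists (fun i => Int_part (b (sigma i))). intros i Hi.
    destruct (rhs_integer d n a b (sigma i) Hpoly) as [z Hz]; [apply Hs, Hi|].
    rewrite Hz, Int_part_IZR. reflexivity. }
  destruct Hz as [bz Hbz]. exists beta, bz.
  split; [assumption|]. split; [assumption|]. split.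
  - intros T N HN HTN.
    set (mu := fun i => T * beta i - IZR (N i)) in *.
    (* The part [T * beta] contributes nothing because [beta] is a relation, so the combination with
       weights [mu] is a lattice vector. *)
    assert (Hrel' : forall j, (j < d)%nat ->
      sumR k (fun i => IZR (N i) * IZR (a (sigma i) j)) =
      - sumR k (fun i => mu i * IZR (a (sigma i) j))).
    { intros j Hj.
      rewrite (sumR_ext k (fun i => mu i * _) (fun i => T * (beta i * IZR (a (sigma i) j)) -
        IZR (N i) * IZR (a (sigma i) j))) by (intros; unfold mu; ring).
      rewrite sumR_minus, sumR_scal, Hrel by assumption. ring. }
    assert (Hy : exists y : nat -> Z, forall j, (j < d)%nat ->
      IZR (y j) = sumR k (fun i => mu i * IZR (a (sigma i) j))).
    { exists (fun j => Int_part (sumR k (fun i => mu i * IZR (a (sigma i) j)))). intros j Hj.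
      destruct (sumR_IZR k (fun i => IZR (N i) * IZR (a (sigma i) j))) as [z Hz].
      { intros i _. exists (N i * a (sigma i) j)%Z. rewrite mult_IZR. reflexivity. }
      rewrite Hrel' in Hz by assumption.
      replace (sumR k (fun i => mu i * IZR (a (sigma i) j))) with (IZR (- z))
        by (rewrite opp_IZR; lra).
      rewrite Int_part_IZR. reflexivity. }
    destruct Hy as [y Hy].
    destruct Hpoly as (Hbd & Hfd & _).
    destruct Hqcd as (Hqp & _ & _).
    assert (Hy0 : forall j, (j < d)%nat -> y j = 0%Z).
    { apply (small_core_combination_zero d n a b alpha (/ q) x k sigma mu); auto.
      - apply full_dim_nonempty, Hfd.
      - apply Rinv_0_lt_compat, Hqp. }
    set (Sm := sumR k (fun i => IZR (N i))).
    (* [N] is now a relation too; subtracting [Sm] times [beta] leaves one of total weight zero,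
       which vanishes by independence. *)
    assert (Ht : forall i, (i < k)%nat -> 1 * IZR (N i) + - Sm * beta i = 0).
    { apply (Hind (fun i => 1 * IZR (N i) + - Sm * beta i)).
      - intros j Hj.
        rewrite (sumR_ext k _ (fun i => 1 * (IZR (N i) * IZR (a (sigma i) j)) +
          - Sm * (beta i * IZR (a (sigma i) j)))) by (intros; ring).
        rewrite sumR_lin, Hrel', Hrel, <- Hy, Hy0 by assumption. ring.
      - rewrite sumR_lin, Hsum. fold Sm. ring. }
    intros i Hi. specialize (Ht i Hi). lra.
  (* Tightness gives [b (sigma i)] as [/ q] plus the scalar product with [x]; averaging by [beta]
     cancels the products. *)
  - rewrite (sumR_ext k _ (fun i => / q * beta i + 1 *
      (beta i * dotR d (fun j => IZR (a (sigma i) j)) x))).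
    + rewrite sumR_lin, Hsum, dotR_sum.
      replace (dotR d _ x) with 0; [ring|].
      symmetry. apply sumR_eq0. intros j Hj. rewrite Hrel by assumption. ring.
    + intros i Hi. destruct (Hs i Hi) as [_ E]. rewrite <- Hbz by assumption.
      change (dotR d (fun j => IZR (a (sigma i) j)) x = b (sigma i) - / q) in E.
      rewrite E. ring.
Qed.
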